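(* Let $\Delta(\mathcal H)$ be the clique complex of a $d$-uniform hypergraph $\mathcal H$ on vertex set $[n]$, let $k$ be a field, and put $g=\mathrm{depth}_R(R/I_{\Delta(\mathcal H)})$. Let $r\ge0$ be the minimal number such that $$\beta_{n-g-r,\;n-g-r+d-1}(R/I_{\Delta(\mathcal H)})\neq0$$ (it being assumed that such a number exists); that is, $r$ is the minimal number such that there exists $V\subseteq[n]$ with $|V|=n-(g-d+r+1)$ and $\tilde H_{d-2}(\Delta(\mathcal H)_V;k)\ne0$. Then $$\mathrm{con}(\mathcal H)=g-d+r+1 .$$
   Context: A hypergraph $\mathcal H$ consists of a finite vertex set and a finite collection $\mathcal E(\mathcal H)$ of subsets, called edges; it is $d$-uniform if every edge has cardinality $d$. All hypergraphs are simple (every edge has at least two vertices, so $d\ge 2$, and no edge contains another). The clique complex is $\Delta(\mathcal H)=\{F\subseteq[n]: \text{every } d\text{-subset of }F\text{ is an edge of }\mathcal H\}$. For a simplicial complex $\Delta$ and $V\subseteq[n]$, $\Delta_V=\{F\in\Delta: F\subseteq V\}$. The connectivity over $k$ of $\mathcal H$ is $\mathrm{con}(\mathcal H)=\min\{|V| : V\subseteq[n],\ \dim_k\tilde H_{d-2}(\Delta(\mathcal H)_{[n]\setminus V};k)\neq0\}$, where $\tilde H$ denotes reduced simplicial homology. $R=k[x_1,\dots,x_n]$, $I_\Delta$ is the Stanley–Reisner ideal of $\Delta$, and $\beta_{i,j}(M)=\dim_k\mathrm{Tor}_i^R(M,k)_j$ are the $\mathbb N$-graded Betti numbers. *)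

(* Defs.v *)
From HB Require Import structures.
From mathcomp Require Import all_boot all_order all_algebra.
From mathcomp.multinomials Require Import freeg mpoly.

Set Implicit Arguments.
Unset Strict Implicit.
Unset Printing Implicit Defensive.

Import GRing.Theory.
Local Open Scope ring_scope.

Definition is_min (P : nat -> Prop) (m : nat) : Prop :=
  P m /\ (forall l, P l -> (m <= l)%N).

(* Vertices are numbered from 0: the vertex set [n] is 'I_n. *)
Record hypergraph (n : nat) := Hypergraph {
  edges : {set {set 'I_n}};
  edges_gt1 : forall e, e \in edges -> (2 <= #|e|)%N;
  edges_antichain : forall e f, e \in edges -> f \in edges ->
    e \subset f -> e = f
}.

Definition uniform n (d : nat) (H : hypergraph n) : Prop :=
  forall e, e \in edges H -> #|e| = d.

(* A simplicial complex on 'I_n is given by its set of faces (empty face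
   included).  Every set with fewer than d elements is a face here. *)
Definition clique_complex n (d : nat) (H : hypergraph n) : {set {set 'I_n}} :=
  [set F : {set 'I_n} |
    [forall e : {set 'I_n}, (e \subset F) && (#|e| == d) ==> (e \in edges H)]].

Definition induced n (D : {set {set 'I_n}}) (V : {set 'I_n}) :
  {set {set 'I_n}} := [set F in D | F \subset V].

(* Matrices act on row vectors from the right, so that
   k^m --A--> k^n --B--> k^p has homology ker B / im A at k^n. *)
Definition homology_dim (k : fieldType) (m n p : nat)
  (A : 'M[k]_(m, n)) (B : 'M[k]_(n, p)) : nat :=
  (\rank (kermx B) - \rank A)%N.

Section SimplicialHomology.
Variables (k : fieldType) (n : nat) (D : {set {set 'I_n}}).

Definition faces (s : nat) : {set {set 'I_n}} := [set F in D | #|F| == s].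

Definition incidence (F G : {set 'I_n}) : k :=
  \sum_(v in F | G == F :\ v) (-1) ^+ #|[set u in F | (u < v)%N]|.

(* From faces of cardinality i.+1 (dimension i) to faces of cardinality i;
   [boundary 0] is the augmentation to the span of the empty face. *)
Definition boundary (i : nat) : 'M[k]_(#|faces i.+1|, #|faces i|) :=
  \matrix_(p, q) incidence (enum_val p) (enum_val q).

Definition reduced_homology_dim (i : nat) : nat :=
  homology_dim (boundary i.+1) (boundary i).

End SimplicialHomology.

(* con(H) = c over k; there is no such c when no set V disconnects H. *)
Definition is_connectivity (k : fieldType) n (d : nat) (H : hypergraph n)
  (c : nat) : Prop :=
  is_min (fun l => exists2 V : {set 'I_n}, #|V| = l &
    reduced_homology_dim k (induced (clique_complex d H) (~: V)) d.-2 != 0%N) c.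

(* Membership in the ideal generated by a finite sequence. *)
Definition in_ideal (R : comNzRingType) (gs : seq R) (f : R) : Prop :=
  exists c : 'I_(size gs) -> R, f = \sum_i c i * gs`_i.

Definition stanley_reisner (k : fieldType) n (D : {set {set 'I_n}}) :
  seq {mpoly k[n]} :=
  [seq \prod_(i in F) 'X_i | F : {set 'I_n} <- enum (~: D)].

(* fs is a regular sequence on R/(gs). *)
Definition regular_seq (R : comNzRingType) (gs fs : seq R) : Prop :=
  ~ in_ideal (gs ++ fs) 1 /\
  forall i, (i < size fs)%N -> forall p : R,
    in_ideal (gs ++ take i fs) (fs`_i * p) -> in_ideal (gs ++ take i fs) p.

(* depth_R (R/(gs)) = g, as the maximal length of a regular sequence
   in the graded maximal ideal (x_1, ..., x_n) of R = k[x_1, ..., x_n]. *)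
Definition is_depth (k : fieldType) n (gs : seq {mpoly k[n]}) (g : nat) :
  Prop :=
  let admissible (fs : seq {mpoly k[n]}) :=
    regular_seq gs fs /\
    (forall f, f \in fs -> in_ideal [seq 'X_i | i <- enum 'I_n] f) in
  (exists2 fs, admissible fs & size fs = g) /\
  (forall fs, admissible fs -> (size fs <= g)%N).

(* A graded resolution ... -> F_1 -> F_0 -> R/(gs) -> 0 by free modules of
   finite rank, where F_i has a homogeneous basis of size [frank i] whose q-th
   element has degree [fdeg q].  Elements of F_i are row vectors, and the
   augmentation is given by homogeneous representatives of the images of the
   basis of F_0. *)
Record graded_free_resolution (k : fieldType) n (gs : seq {mpoly k[n]}) :=
  GradedFreeResolution {
  frank : nat -> nat;
  fdeg : forall i, 'I_(frank i) -> nat;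
  fdiff : forall i, 'M[{mpoly k[n]}]_(frank i.+1, frank i);
  faug : 'cV[{mpoly k[n]}]_(frank 0);
  fdiff_homog : forall i p q m,
    m \in msupp (fdiff i p q) -> (mdeg m + fdeg q)%N = fdeg p;
  faug_homog : forall q m, m \in msupp (faug q 0) -> mdeg m = fdeg q;
  faug_onto : forall f, exists u : 'rV_(frank 0),
    in_ideal gs (f - (u *m faug) 0 0);
  faug_exact : forall u : 'rV_(frank 0),
    in_ideal gs ((u *m faug) 0 0) <-> exists v, u = v *m fdiff 0;
  fdiff_exact : forall i (u : 'rV_(frank i.+1)),
    u *m fdiff i = 0 <-> exists v, u = v *m fdiff i.+1
}.

Section Betti.
Variables (k : fieldType) (n : nat) (gs : seq {mpoly k[n]}).
Variable F : graded_free_resolution gs.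

Definition basis_deg (i j : nat) : {set 'I_(frank F i)} :=
  [set q | fdeg q == j].

(* The degree j part of fdiff i (x) k : F_{i+1} (x) k -> F_i (x) k, with
   k = R/(x_1, ..., x_n); [p@_0] is the constant coefficient of p. *)
Definition fdiff_k (i j : nat) :
  'M[k]_(#|basis_deg i.+1 j|, #|basis_deg i j|) :=
  \matrix_(p, q) (fdiff F i (enum_val p) (enum_val q))@_0%MM.

(* dim_k Tor_i^R(R/(gs), k)_j = dim_k H_i(F (x) k)_j. *)
Definition betti (i j : nat) : nat :=
  match i with
  | 0 => #|basis_deg 0 j| - \rank (fdiff_k 0 j)
  | i'.+1 => homology_dim (fdiff_k i'.+1 j) (fdiff_k i' j)
  end.

End Betti.

(* Main.v *)
(* The degree j part of Tor_i(R/I, k) is computed by the Koszul complex of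
   x_1, ..., x_n with coefficients in R/I.  Its part of multidegree a is
   contractible unless a is squarefree, with support V say, and is then the
   augmented cochain complex of Delta_V.  For j = i + d - 1 only the groups
   H~_(d-2)(Delta_V) with |V| = i + d - 1 contribute (Hochster).  Since Tor is
   given by an arbitrary free resolution F, the Koszul homology of R/I is
   identified with the homology of F (x) k by shifting dimension along the
   syzygies of F.  Finally, a regular sequence of length g in (x_1, ..., x_n)
   forces H_i(x; R/I) = 0 for i > n - g, so that H~_(d-2)(Delta_V) = 0 as soon
   as |V| > n - g + d - 1: no disconnecting set corresponds to a negative r. *)
Require Import Defs.
From HB Require Import structures.
From mathcomp Require Import all_boot all_order all_algebra.
From mathcomp.multinomials Require Import freeg mpoly.
From mathcomp Require Import zify.

Set Implicit Arguments.
Unset Strict Implicit.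
Unset Printing Implicit Defensive.

Import GRing.Theory.
Local Open Scope ring_scope.

(** * The Koszul complex *)

Section Koszul.
Variables (R : comNzRingType) (n : nat).
Implicit Types (S T : {set 'I_n}) (v u : 'I_n) (x : 'I_n -> R).

Definition setN := #|{set 'I_n}|.

Definition nth_set (p : 'I_setN) : {set 'I_n} := enum_val p.
Definition set_rank S : 'I_setN := enum_rank S.

Lemma nth_setK : cancel nth_set set_rank. Proof. exact: enum_valK. Qed.
Lemma set_rankK : cancel set_rank nth_set. Proof. exact: enum_rankK. Qed.

Definition pos v S : nat := #|[set u in S | (u < v)%N]|.

(** The Koszul differential, acting from the left on columns of coordinates of the $e_S$. One square
    matrix over all subsets serves every degree, and degrees are imposed separately as support
    conditions. *)
Definition kosz x : 'M[R]_setN :=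
  \matrix_(p, q) \sum_(v | (v \notin nth_set p) &&
    (nth_set q == v |: nth_set p)) (-1) ^+ pos v (nth_set p) * x v.

(** Exterior multiplication by $e_v$. *)
Definition wedge v : 'M[R]_setN :=
  \matrix_(p, q) (((v \in nth_set p) && (nth_set q == nth_set p :\ v))%:R
    * (-1) ^+ pos v (nth_set q)).

Lemma sum_setN (V : nmodType) (f : 'I_setN -> V) :
  \sum_p f p = \sum_(S : {set 'I_n}) f (set_rank S).
Proof.
by rewrite (reindex set_rank) //=; apply: onW_bij; exact: enum_rank_bij.
Qed.

Lemma koszE x m (w : 'M[R]_(setN, m)) T b :
  (kosz x *m w) (set_rank T) b =
  \sum_(v | v \notin T) (-1) ^+ pos v T * x v * w (set_rank (v |: T)) b.
Proof.
rewrite mxE sum_setN.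
under eq_bigr do rewrite mxE !set_rankK mulr_suml big_mkcondr /=.
rewrite exchange_big; apply: eq_bigr => v vT.
by rewrite -big_mkcond big_pred1_eq.
Qed.

Lemma wedgeE v m (w : 'M[R]_(setN, m)) T b :
  (wedge v *m w) (set_rank T) b =
  if v \in T then (-1) ^+ pos v (T :\ v) * w (set_rank (T :\ v)) b else 0.
Proof.
rewrite mxE sum_setN.
under eq_bigr do rewrite mxE !set_rankK.
case: ifP => vT; last by rewrite big1 // => S _; rewrite /= !mul0r.
rewrite (bigD1 (T :\ v)) //= eqxx mul1r big1 ?addr0 // => S /negPf ->.
by rewrite !mul0r.
Qed.

Lemma posU1 u v T : u \notin T ->
  pos v (u |: T) = ((u < v) + pos v T)%N.
Proof.
move=> uT; rewrite /pos; case: ltnP => uv.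
  have -> : [set z in u |: T | (z < v)%N] = u |: [set z in T | (z < v)%N].
    by apply/setP=> z; rewrite !inE; case: eqP => // ->; rewrite uv.
  by rewrite cardsU1 inE (negPf uT).
congr #|pred_of_set _|; apply/setP=> z; rewrite !inE; case: eqP => //= ->.
by rewrite ltnNge uv andbF.
Qed.

(** This sign gives $d^2=0$. Its companion [sign_swapU], where one element enters and the other
    leaves, gives the anticommutation behind [kosz_wedge]. *)
Lemma sign_swap u v T : u != v -> u \notin T -> v \notin T ->
  (-1) ^+ pos u T * (-1) ^+ pos v (u |: T) =
  - ((-1) ^+ pos v T * (-1) ^+ pos u (v |: T)) :> R.
Proof.
move=> uv uT vT; rewrite !posU1 // !exprD.
have [h|h|/val_inj h] := ltngtP u v; last by rewrite h eqxx in uv.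
  by rewrite expr1 expr0 !mul1r mulN1r mulrN mulrC.
by rewrite expr1 expr0 mul1r mulN1r mulrN opprK mulrC.
Qed.

Lemma sign_swapU u v T : u != v -> u \notin T -> v \notin T ->
  (-1) ^+ pos u (v |: T) * (-1) ^+ pos v (u |: T) =
  - ((-1) ^+ pos v T * (-1) ^+ pos u T) :> R.
Proof.
move=> uv uT vT; rewrite !posU1 // !exprD.
have [h|h|/val_inj h] := ltngtP u v; last by rewrite h eqxx in uv.
  by rewrite expr1 expr0 mul1r mulN1r mulrN mulrC.
by rewrite expr1 expr0 !mul1r mulN1r mulNr mulrC.
Qed.

(** The terms with $u<v$ are paired with those with $v<u$; no division by 2 occurs, so
    characteristic 2 is covered. *)
Lemma sum_antisym (V : zmodType) (P : pred 'I_n) (f : 'I_n -> 'I_n -> V) :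
  (forall u v, P u -> P v -> u != v -> f u v = - f v u) ->
  \sum_(u | P u) \sum_(v | P v && (v != u)) f u v = 0.
Proof.
move=> fN.
have E : forall u, \sum_(v | P v && (v != u)) f u v =
    \sum_(v | P v && (u < v)%N) f u v + \sum_(v | P v && (v < u)%N) f u v.
  move=> u; rewrite (bigID (fun v : 'I_n => (u < v)%N)) /=; congr (_ + _).
    apply: eq_bigl => v; rewrite -andbA; congr andb.
    by case: eqP => // ->; rewrite ltnn.
  apply: eq_bigl => v; rewrite -andbA -leqNgt ltn_neqAle; congr andb.
under eq_bigr do rewrite E.
rewrite big_split /= [X in X + _](exchange_big_dep P) //=; last first.
  by move=> u v _ /andP[].
rewrite -big_split /= big1 // => u Pu.
under eq_bigl do rewrite Pu /=.
rewrite -big_split /= big1 // => v /andP[Pv vu].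
by rewrite fN ?addNr //; apply: contraTneq vu => ->; rewrite ltnn.
Qed.

Lemma matrix_setP m (A B : 'M[R]_(setN, m)) :
  (forall S b, A (set_rank S) b = B (set_rank S) b) -> A = B.
Proof. by move=> AB; apply/matrixP=> p q; rewrite -(nth_setK p). Qed.

Lemma kosz_sqr x : kosz x *m kosz x = 0.
Proof.
rewrite -[X in _ *m X]mulmx1; apply: matrix_setP => T q.
rewrite koszE [RHS]mxE; set w := 1%:M.
rewrite -[RHS](@sum_antisym _ (fun v => v \notin T) (fun u v =>
  (-1) ^+ pos u T * (-1) ^+ pos v (u |: T) * x u * x v
  * w (set_rank (v |: (u |: T))) q)).
  apply: eq_bigr => u uT; rewrite koszE mulr_sumr.
  apply: eq_big => [v|v _]; first by rewrite !inE negb_or andbC.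
  by rewrite !mulrA; congr (_ * _ * _); rewrite mulrAC.
move=> u v uT vT uv; rewrite (sign_swap uv uT vT) setUCA !mulNr.
by congr (- (_ * _)); rewrite mulrAC.
Qed.

(** The term $x_v w_T$ comes from the first composite if $v\notin T$ and from the second if $v\in
    T$; in the latter case the remaining terms cancel by [sign_swapU]. *)
Lemma kosz_wedge x v m (w : 'M[R]_(setN, m)) :
  kosz x *m (wedge v *m w) + wedge v *m (kosz x *m w) = x v *: w.
Proof.
apply: matrix_setP => T q.
rewrite mxE koszE wedgeE [RHS]mxE.
under eq_bigr do rewrite wedgeE !inE.
case: ifP => vT; last first.
  rewrite addr0 (bigD1 v) ?vT //= eqxx /= setU1K ?vT //.
  rewrite mulrACA -expr2 sqrr_sign mul1r.
  rewrite big1 ?addr0 // => u /andP[_ uv].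
  by rewrite (eq_sym v) (negPf uv) mulr0.
have vT' : v \notin T :\ v by rewrite !inE eqxx.
rewrite koszE [X in _ + _ * X](bigD1 v) //= setD1K // mulrDr !mulrA -expr2.
rewrite sqrr_sign mul1r addrCA -[RHS]addr0; congr (_ + _).
rewrite mulr_sumr [X in _ + X](_ : _ = \sum_(u | u \notin T)
    (-1) ^+ pos v (T :\ v) * ((-1) ^+ pos u (T :\ v) * x u *
      w (set_rank (u |: (T :\ v))) q)); last first.
  apply: eq_bigl => u; rewrite !inE negb_and negbK.
  by case: eqP => [->|]; rewrite ?vT ?andbT.
rewrite -big_split /= big1 // => u uT; rewrite orbT.
have uv : u != v by apply: contraNneq uT => ->.
have uT' : u \notin T :\ v by rewrite inE negb_and uT orbT.
have -> : (u |: T) :\ v = u |: (T :\ v).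
  apply/setP=> z; rewrite !inE; case: (z =P v) => // ->.
  by rewrite eq_sym (negPf uv).
have := sign_swapU uv uT' vT'; rewrite setD1K // => e.
by rewrite mulrACA e mulNr !mulrA addNr.
Qed.
End Koszul.

(** * Regular sequences and Koszul homology *)

Section Ideals.
Variable R : comNzRingType.
Implicit Types (gs : seq R) (f g : R).

Lemma in_ideal_ind gs (P : R -> Prop) :
  P 0 -> (forall f g, P f -> P g -> P (f + g)) ->
  (forall r g, g \in gs -> P (r * g)) ->
  forall f, in_ideal gs f -> P f.
Proof.
by move=> P0 PD PM f [c ->]; apply: big_ind => // i _; apply/PM/mem_nth.
Qed.

Lemma in_ideal0 gs : in_ideal gs 0.
Proof. by exists (fun=> 0); rewrite big1 // => i _; rewrite mul0r. Qed.

Lemma in_idealD gs f g : in_ideal gs f -> in_ideal gs g -> in_ideal gs (f + g).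
Proof.
move=> [c ->] [e ->]; exists (fun i => c i + e i).
by rewrite -big_split; apply: eq_bigr => i _; rewrite mulrDl.
Qed.

Lemma in_idealM gs r f : in_ideal gs f -> in_ideal gs (r * f).
Proof.
move=> [c ->]; exists (fun i => r * c i).
by rewrite mulr_sumr; apply: eq_bigr => i _; rewrite mulrA.
Qed.

Lemma in_idealN gs f : in_ideal gs f -> in_ideal gs (- f).
Proof. by rewrite -mulN1r; apply: in_idealM. Qed.

Lemma in_ideal_sum gs (I : Type) (s : seq I) (P : pred I) (F : I -> R) :
  (forall i, P i -> in_ideal gs (F i)) -> in_ideal gs (\sum_(i <- s | P i) F i).
Proof.
by move=> JF; apply: big_ind => //; [apply: in_ideal0|apply: in_idealD].
Qed.

Lemma in_ideal_mem gs g : g \in gs -> in_ideal gs g.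
Proof.
move=> /(nthP 0)[i i_lt <-]; exists (fun j => (j == Ordinal i_lt)%:R).
rewrite (bigD1 (Ordinal i_lt)) //= eqxx mul1r big1 ?addr0 // => j /negPf ->.
by rewrite mul0r.
Qed.

Lemma in_ideal_rcons gs h f : in_ideal (rcons gs h) f ->
  exists2 y, in_ideal gs y & exists r, f = y + r * h.
Proof.
elim/in_ideal_ind: f / => [|f g [y Jy [r ->]] [z Jz [s ->]]|r g].
- by exists 0; [exact: in_ideal0 | exists 0; rewrite mul0r addr0].
- exists (y + z); first exact: in_idealD.
  by exists (r + s); rewrite mulrDl addrACA.
rewrite mem_rcons inE => /predU1P[->|Jg].
  by exists 0; [exact: in_ideal0 | exists r; rewrite add0r].
exists (r * g); first exact/in_idealM/in_ideal_mem.
by exists 0; rewrite mul0r addr0.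
Qed.

Lemma in_ideal_sub gs hs f : {subset gs <= hs} ->
  in_ideal gs f -> in_ideal hs f.
Proof.
move=> sub; elim/in_ideal_ind: f / => [|f g|r g /sub].
- exact: in_ideal0.
- exact: in_idealD.
by move=> /in_ideal_mem; apply: in_idealM.
Qed.

(** Vanishing over $R/(gs)$: quotient modules are handled throughout by representatives over $R$. *)
Definition mx_in gs m p (w : 'M[R]_(m, p)) := forall a b, in_ideal gs (w a b).

Lemma mx_inD gs m p (w z : 'M[R]_(m, p)) :
  mx_in gs w -> mx_in gs z -> mx_in gs (w + z).
Proof. by move=> Jw Jz a b; rewrite mxE; apply: in_idealD. Qed.

Lemma mx_inN gs m p (w : 'M[R]_(m, p)) : mx_in gs w -> mx_in gs (- w).
Proof. by move=> Jw a b; rewrite mxE; apply: in_idealN. Qed.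

Lemma mx_inB gs m p (w z : 'M[R]_(m, p)) :
  mx_in gs w -> mx_in gs z -> mx_in gs (w - z).
Proof. by move=> Jw Jz; apply/mx_inD/mx_inN. Qed.

Lemma mx_inM gs m p q (A : 'M[R]_(m, p)) (w : 'M[R]_(p, q)) :
  mx_in gs w -> mx_in gs (A *m w).
Proof.
by move=> Jw a b; rewrite mxE; apply: in_ideal_sum => i _; apply: in_idealM.
Qed.

Lemma mx_in_rcons gs h m p (w : 'M[R]_(m, p)) : mx_in (rcons gs h) w ->
  exists v, mx_in gs (w - h *: v).
Proof.
move=> Jw.
have /fin_all_exists[v vP] : forall a, exists va : 'I_p -> R,
    forall b, in_ideal gs (w a b - h * va b).
  move=> a; apply: (@fin_all_exists _ (fun=> R)
    (fun b y => in_ideal gs (w a b - h * y))).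
  move=> b; have [y Jy [r ->]] := in_ideal_rcons (Jw a b).
  by exists r; rewrite (mulrC h) addrK.
by exists (\matrix_(a, b) v a b) => a b; rewrite !mxE.
Qed.

End Ideals.

(** * Vanishing of Koszul homology forced by a regular sequence *)

Section DepthBound.
Variables (R : comNzRingType) (n : nat) (x : 'I_n -> R).

Definition kosz_deg i (w : 'cV[R]_(setN n)) :=
  forall (S : {set 'I_n}) b, #|S| != i -> w (set_rank S) b = 0.

(** By linearity from [kosz_wedge]: if $f=\sum r_v x_v$, then $\sum r_v e_v$ acts as a homotopy. *)
Lemma kosz_homotopy f : in_ideal [seq x i | i <- enum 'I_n] f ->
  exists h : 'M[R]_(setN n),
    (forall m (w : 'M[R]_(_, m)),
       kosz x *m (h *m w) + h *m (kosz x *m w) = f *: w) /\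
    (forall (w : 'cV[R]_(setN n)) i, kosz_deg i w -> kosz_deg i.+1 (h *m w)).
Proof.
elim/in_ideal_ind: f / => [|f g [h [hE hd]] [h' [hE' hd']]|r g].
- exists 0; split=> [m w|w i w0 S b _]; last by rewrite mul0mx mxE.
  by rewrite !mul0mx mulmx0 addr0 scale0r.
- exists (h + h'); split=> [m w|w i w0 S b iS].
    by rewrite !mulmxDl mulmxDr addrACA hE hE' scalerDl.
  by rewrite mulmxDl mxE (hd _ i) ?(hd' _ i) ?addr0.
move=> /mapP[v _ ->]; exists (r *: wedge R v); split=> [m w|w i w0 S b iS].
  by rewrite -!scalemxAl -scalemxAr -scalerDr kosz_wedge scalerA.
rewrite -scalemxAl mxE wedgeE; case: ifP => vS; last by rewrite mulr0.
rewrite w0 ?mulr0 //; apply: contra iS => /eqP <-.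
by rewrite (cardsD1 v S) vS.
Qed.

(* An element of (x) kills Koszul homology, so H_i(x; M) embeds into
   H_{i+1}(x; M/fM) for every M-regular f in (x). *)
Lemma kosz_depth gs fs : regular_seq gs fs ->
  (forall f, f \in fs -> in_ideal [seq x i | i <- enum 'I_n] f) ->
  forall i (w : 'cV[R]_(setN n)), (n < i + size fs)%N ->
  kosz_deg i w ->
  mx_in gs (kosz x *m w) -> exists e, mx_in gs (w - kosz x *m e).
Proof.
(* Induction on [l]: $H_i(x;R/J)=0$ for $i>n-l$, where [J] adjoins to [gs] all but the last [l]
   elements of [fs]. *)
move=> [_ reg] fsx; suff step l : (l <= size fs)%N ->
    let J := gs ++ take (size fs - l) fs in
    forall i (w : 'cV[R]_(setN n)), (n < i + l)%N ->
    kosz_deg i w ->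
    mx_in J (kosz x *m w) -> exists e, mx_in J (w - kosz x *m e).
  by have := step _ (leqnn (size fs)); rewrite subnn take0 cats0.
elim: l => [|l IHl] l_lt /= i w ni w0 Jw.
  (* For [l = 0] the degree [i] exceeds [n], and no subset is that large. *)
  exists 0; rewrite mulmx0 subr0 => p b; rewrite -(nth_setK p) w0.
    exact: in_ideal0.
  rewrite neq_ltn (leq_ltn_trans (max_card _)) // card_ord; lia.
move: Jw; set a := (size fs - l.+1)%N; set J := gs ++ _ => Jw.
have a_lt : (a < size fs)%N by lia.
have JE : gs ++ take a.+1 fs = rcons J fs`_a.
  by rewrite /J (take_nth 0) // -rcons_cat.
have [h [hE hd]] := kosz_homotopy (fsx _ (mem_nth 0 a_lt)).
have := IHl (ltnW l_lt) i.+1 (h *m w).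
rewrite -subSS subSn // JE => /(_ _ _ _)/=[|||u Ju].
- by rewrite addSnnS.
- exact: hd.
(* Writing $f$ for the element of index [a], $hw$ is a cycle modulo $(J,f)$, in degree $i+1$. *)
- have -> : kosz x *m (h *m w) = fs`_a *: w - h *m (kosz x *m w).
    by rewrite -hE addrK.
  apply: mx_inB => [p b|].
    rewrite mxE mulrC; apply/in_idealM/in_ideal_mem.
    by rewrite mem_rcons mem_head.
  apply: mx_inM => p b; apply: in_ideal_sub (Jw p b) => g.
  by rewrite mem_rcons inE orbC => ->.
(* Now $hw\equiv du+fv$ modulo $J$. Applying $d$ gives $f(w-dv)\in J$, and $f$ cancels by
   regularity. *)
have [v Jv] := mx_in_rcons Ju.
exists v => p b; apply: (reg _ a_lt).
have : mx_in J (fs`_a *: (w - kosz x *m v)).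
  have -> : fs`_a *: (w - kosz x *m v) =
     kosz x *m (h *m w - kosz x *m u - fs`_a *: v) + h *m (kosz x *m w).
    rewrite !mulmxBr !mulmxA kosz_sqr mul0mx subr0 -!mulmxA.
    by rewrite scalerBr -scalemxAr addrAC hE.
  by apply: mx_inD; apply: mx_inM.
by move=> /(_ p b); rewrite mxE.
Qed.

End DepthBound.

(** * Monomials and monomial ideals *)

Section Monomials.
Variables (k : fieldType) (n : nat).
Local Notation R := {mpoly k[n]}.
Implicit Types (S T F : {set 'I_n}) (m : 'X_{1..n}) (D : {set {set 'I_n}}).

Definition mset S : 'X_{1..n} := [multinom (i \in S : nat) | i < n].
Definition msup m : {set 'I_n} := [set i | m i != 0%N].

Lemma msetE S i : mset S i = (i \in S). Proof. exact: mnmE. Qed.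

Lemma msetU1 v T : v \notin T -> mset (v |: T) = (U_(v) + mset T)%MM.
Proof.
move=> vT; apply/mnmP=> i; rewrite mnmDE mnm1E !msetE !inE eq_sym.
by case: eqP => //= <-; rewrite (negPf vT).
Qed.

Lemma mdeg_mset S : mdeg (mset S) = #|S|.
Proof.
rewrite mdegE -sum1_card [RHS]big_mkcond; apply: eq_bigr => i _.
by rewrite msetE; case: (i \in S).
Qed.

Lemma mset_le S (a : 'X_{1..n}) : (mset S <= a)%MM = (S \subset msup a).
Proof.
apply/mnm_lepP/subsetP => [le i iS|sub i].
  by have := le i; rewrite in_set msetE iS; case: (a i).
by rewrite msetE; case: (boolP (i \in S)) => // /sub; rewrite in_set lt0n.
Qed.

Lemma mpolyX_mset F : \prod_(i in F) 'X_i = 'X_[mset F] :> R.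
Proof.
rewrite mpolyXE_id big_mkcond; apply: eq_bigr => i _.
by rewrite msetE; case: (i \in F).
Qed.

Lemma mcoeffXM v (p : R) m :
  ('X_v * p)@_m = if (U_(v) <= m)%MM then p@_(m - U_(v)) else 0.
Proof.
case: ifP => le; first by rewrite -[m in LHS](submK le) addmC mulrC mcoeffMX.
apply/eqP; rewrite mcoeff_eq0 mulrC; apply: contraFN le.
rewrite (perm_mem (msuppMX _ _)) => /mapP[m' _ ->].
exact: lem_addr.
Qed.

Definition mpart (P : pred 'X_{1..n}) (p : R) : R :=
  \sum_(m <- msupp p | P m) p@_m *: 'X_[m].

Lemma mcoeff_mpart P p m : (mpart P p)@_m = if P m then p@_m else 0.
Proof.
rewrite /mpart raddf_sum /=.
rewrite [RHS](_ : _ = \sum_(m' <- msupp p | P m') (m' == m)%:R * p@_m).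
  by apply: eq_bigr => m' _; rewrite mcoeffZ mcoeffX; case: eqP => [->|];
     rewrite ?mulr1 ?mul1r ?mulr0 ?mul0r.
rewrite -mulr_suml; have [m_p|m_p] := boolP (m \in msupp p); last first.
  by move: m_p; rewrite -mcoeff_eq0 => /eqP ->; rewrite mulr0 if_same.
rewrite big_mkcond (bigD1_seq m) ?msupp_uniq //= eqxx big1 => [|m' /negPf ->].
  by rewrite addr0; case: ifP; rewrite ?mul1r ?mul0r.
by rewrite if_same.
Qed.

Lemma mpartM P Q (f p : R) :
  (forall m1 m2, m1 \in msupp f -> P (m1 + m2)%MM = Q m2) ->
  mpart P (f * p) = f * mpart Q p.
Proof.
move=> PQ; apply/mpolyP=> m; rewrite mcoeff_mpart !mcoeffM.
case: ifP => Pm; last (symmetry; apply: big1 => -[m1 m2] /=).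
  apply: eq_bigr => -[m1 m2] /= /eqP mE; rewrite mcoeff_mpart.
  have [/PQ <-|] := boolP (bmnm m1 \in msupp f); first by rewrite -mE Pm.
  by rewrite -mcoeff_eq0 => /eqP ->; rewrite !mul0r.
move=> /eqP mE; rewrite mcoeff_mpart.
have [/PQ <-|] := boolP (bmnm m1 \in msupp f); first by rewrite -mE Pm mulr0.
by rewrite -mcoeff_eq0 => /eqP ->; rewrite mul0r.
Qed.

(** The predicate varies with the entry because basis elements carry different degree shifts.
    Homogeneity of [w] is expressed below as [hproj P w = w]. *)
Definition hproj p q (P : 'I_p -> 'I_q -> pred 'X_{1..n}) (w : 'M[R]_(p, q)) :=
  \matrix_(a, b) mpart (P a b) (w a b).

Lemma mpart_sum (I : Type) (s : seq I) (Q : pred I) P (F : I -> R) :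
  mpart P (\sum_(i <- s | Q i) F i) = \sum_(i <- s | Q i) mpart P (F i).
Proof.
apply/mpolyP=> m; rewrite mcoeff_mpart !raddf_sum /=; case: ifP => Pm.
  by apply: eq_bigr => i _; rewrite mcoeff_mpart Pm.
by rewrite big1 // => i _; rewrite mcoeff_mpart Pm.
Qed.

Lemma hproj_mulr p q r (P : 'I_p -> 'I_q -> pred 'X_{1..n}) P'
    (w : 'M[R]_(p, q)) (A : 'M[R]_(q, r)) :
  (forall a b c m1 m2, m1 \in msupp (A b c) ->
    P' a c (m1 + m2)%MM = P a b m2) ->
  hproj P' (w *m A) = hproj P w *m A.
Proof.
move=> PP; apply/matrixP=> a c; rewrite !mxE mpart_sum; apply: eq_bigr => b _.
by rewrite !mxE mulrC (@mpartM _ (P a b)) 1?mulrC // => m1 m2; apply: PP.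
Qed.

Lemma hproj_mull p q r (P : 'I_q -> 'I_r -> pred 'X_{1..n}) P'
    (A : 'M[R]_(p, q)) (w : 'M[R]_(q, r)) :
  (forall a b c m1 m2, m1 \in msupp (A a b) ->
    P' a c (m1 + m2)%MM = P b c m2) ->
  hproj P' (A *m w) = A *m hproj P w.
Proof.
move=> PP; apply/matrixP=> a c; rewrite !mxE mpart_sum; apply: eq_bigr => b _.
by rewrite !mxE (@mpartM _ (P b c)) // => m1 m2; apply: PP.
Qed.

Lemma hproj_idem p q P (w : 'M[R]_(p, q)) : hproj P (hproj P w) = hproj P w.
Proof.
apply/matrixP=> a b; rewrite !mxE; apply/mpolyP=> m.
by rewrite !mcoeff_mpart; case: (P a b m).
Qed.

Lemma hprojB p q P (w z : 'M[R]_(p, q)) :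
  hproj P (w - z) = hproj P w - hproj P z.
Proof.
apply/matrixP=> a b; rewrite !mxE; apply/mpolyP=> m.
by rewrite !mcoeffB !mcoeff_mpart !mcoeffB; case: ifP; rewrite ?subr0.
Qed.

Lemma hproj_supp p q P (w : 'M[R]_(p, q)) a b m :
  hproj P w = w -> m \in msupp (w a b) -> P a b m.
Proof.
move=> <-; rewrite mxE mcoeff_msupp mcoeff_mpart.
by case: ifP; rewrite ?eqxx.
Qed.

Definition down_closed D := forall F T, F \in D -> T \subset F -> T \in D.

(** A monomial with nonface support is a multiple of the generator attached to that support;
    conversely, multiples of a generator have nonface support because [D] is closed under
    subsets. *)
Lemma in_stanley_reisner D (f : R) : down_closed D ->
  in_ideal (stanley_reisner k D) f <->
  (forall m, m \in msupp f -> msup m \notin D).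
Proof.
move=> Dd; split=> [|fD].
  elim/in_ideal_ind: f / => [m|f g If Ig m|r g].
  - by rewrite msupp0.
  - by move=> /msuppD_le; rewrite mem_cat => /orP[/If|/Ig].
  move=> /mapP[F]; rewrite mem_enum inE => FD -> m.
  rewrite mpolyX_mset (perm_mem (msuppMX _ _)) => /mapP[m' _ ->].
  apply: contra FD => /Dd; apply; apply/subsetP=> i iF.
  by rewrite in_set mnmDE msetE iF.
rewrite (mpolyE f) big_seq; apply: in_ideal_sum => m /fD mD.
have -> : 'X_[m] = 'X_[m - mset (msup m)] * \prod_(i in msup m) 'X_i :> R.
  by rewrite mpolyX_mset -mpolyXD submK // mset_le.
rewrite scalerAl; apply/in_idealM/in_ideal_mem/mapP.
by exists (msup m) => //; rewrite mem_enum inE.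
Qed.

End Monomials.

(** * Multidegrees of the Koszul complex *)

Section PolynomialKoszul.
Variables (k : fieldType) (n : nat).
Local Notation R := {mpoly k[n]}.
Local Notation N := (setN n).
Local Notation kX := (kosz (fun v : 'I_n => 'X_v : R)).
Local Notation k1 := (kosz (fun _ : 'I_n => 1 : k)).
Implicit Types (S T : {set 'I_n}) (D : {set {set 'I_n}}).

(** Coordinates of the multidegree [a] part of [w] in the basis $e_S x^{a-S}$, $S\le a$. *)
Definition dehom (a : 'X_{1..n}) (w : 'cV[R]_N) : 'cV[k]_N :=
  \col_s (if (mset (nth_set s) <= a)%MM
          then (w s 0)@_(a - mset (nth_set s)) else 0).

Lemma dehomE a w S b : dehom a w (set_rank S) b =
  if (mset S <= a)%MM then (w (set_rank S) 0)@_(a - mset S) else 0.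
Proof. by rewrite mxE set_rankK. Qed.

Lemma mcoeff_sign (e : nat) (p : R) m : ((-1) ^+ e * p)@_m = (-1) ^+ e * p@_m.
Proof.
rewrite -signr_odd -[in RHS]signr_odd; case: odd; last by rewrite !mul1r.
by rewrite !mulN1r mcoeffN.
Qed.

Lemma msetU1_le v T a : v \notin T -> (mset T <= a)%MM ->
  (mset (v |: T) <= a)%MM = (U_(v) <= a - mset T)%MM.
Proof.
move=> vT leT; rewrite lep1mP mnmBE msetE (negPf vT) subn0.
by rewrite mset_le subUset sub1set in_set -mset_le leT andbT.
Qed.

(** Multiplication by $x_v$ sends $x^{a-(T\cup v)}$ to $x^{a-T}$, so in these coordinates every
    variable becomes 1. *)
Lemma dehom_kosz a w : dehom a (kX *m w) = k1 *m dehom a w.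
Proof.
apply: matrix_setP => T b; rewrite dehomE !koszE; case: ifP => leT; last first.
  rewrite big1 // => v vT; rewrite dehomE.
  case: ifP => [|_]; last by rewrite mulr0.
  by rewrite mset_le subUset sub1set in_set -mset_le leT andbF.
rewrite raddf_sum; apply: eq_bigr => v vT /=.
rewrite -mulrA mcoeff_sign mulr1 mcoeffXM dehomE msetU1_le //.
by case: ifP => // _; rewrite msetU1 // addmC submDA.
Qed.

Lemma dehomB a w z : dehom a (w - z) = dehom a w - dehom a z.
Proof.
apply: matrix_setP => S b; rewrite !(dehomE, mxE).
by case: ifP; rewrite ?mcoeffB ?subr0.
Qed.

Definition below (a : 'X_{1..n}) (c : 'cV[k]_N) :=
  forall S b, ~~ (mset S <= a)%MM -> c (set_rank S) b = 0.

(** Assembles one vector from prescribed multidegree parts; the bound [K] on total degree keeps the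
    family finite. *)
Definition rehom (K : nat) (c : 'X_{1..n < K} -> 'cV[k]_N) : 'cV[R]_N :=
  \col_s \sum_(a | (mset (nth_set s) <= bmnm a)%MM)
    c a s 0 *: 'X_[bmnm a - mset (nth_set s)].

Lemma dehom_rehom K (c : 'X_{1..n < K} -> 'cV[k]_N) (a : 'X_{1..n < K}) :
  below a (c a) -> dehom a (rehom c) = c a.
Proof.
move=> ca; apply: matrix_setP => S b; rewrite dehomE mxE set_rankK !ord1.
case: ifPn => le; last by rewrite ca.
rewrite raddf_sum (bigD1 a) //= mcoeffZ mcoeffX eqxx mulr1.
rewrite big1 ?addr0 // => a' /andP[le' ne]; rewrite mcoeffZ mcoeffX.
case: eqP => [e|]; last by rewrite mulr0.
by case/eqP: ne; apply: val_inj => /=; rewrite -(submK le) -e submK.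
Qed.

(* [surv D a S]: the basis element e_S x^(a - S) of multidegree a of the Koszul
   complex is nonzero modulo I_D. *)
Definition surv D (a : 'X_{1..n}) S :=
  (mset S <= a)%MM && (msup (a - mset S) \in D).

Definition vanish D (w : 'cV[R]_N) :=
  forall a S, surv D a S -> dehom a w (set_rank S) 0 = 0.

Lemma vanish_stanley_reisner D w : down_closed D ->
  mx_in (stanley_reisner k D) w <-> vanish D w.
Proof.
move=> Dd; split=> [Iw a S /andP[le aD]|w0 s b].
  rewrite dehomE le; apply/eqP; rewrite mcoeff_eq0; apply: contraL aD.
  exact: (proj1 (in_stanley_reisner _ Dd) (Iw _ _)).
rewrite ord1; apply/in_stanley_reisner => // m mw; apply/negP => mD.
have le : (mset (nth_set s) <= m + mset (nth_set s))%MM by rewrite lem_addl.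
have := w0 (m + mset (nth_set s))%MM (nth_set s).
rewrite /surv dehomE le addmK nth_setK => /(_ mD) /eqP.
by rewrite mcoeff_eq0 mw.
Qed.

(** When every set is a face the Stanley-Reisner ideal is zero, so the multidegree analysis also
    applies to $R$ itself. *)
Lemma vanishT w : vanish setT w -> w = 0.
Proof.
move=> w0; apply: matrix_setP => S b; rewrite ord1 mxE; apply/mpolyP=> m.
rewrite mcoeff0; have := w0 (m + mset S)%MM S.
by rewrite /surv dehomE lem_addl addmK inE => ->.
Qed.

Definition bounds D a (c : 'cV[k]_N) := exists2 b, below a b &
  forall S, surv D a S -> c (set_rank S) 0 = (k1 *m b) (set_rank S) 0.

Lemma vanish_local D w : (forall a, bounds D a (dehom a w)) ->
  exists e, vanish D (w - kX *m e).
Proof.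
(* [K] exceeds the total degree of every multidegree where [w] is nonzero: $e_S$ contributes at most
   [n], its coefficient less than its [msize]. *)
move=> loc; pose K := (n + \sum_s msize (w s 0%R)).+1.
have /fin_all_exists[b bP] : forall a : 'X_{1..n < K}, exists b, below a b /\
    forall S, surv D a S -> dehom a w (set_rank S) 0 = (k1 *m b) (set_rank S) 0.
  by move=> a; have [b ab bE] := loc a; exists b.
exists (rehom b) => a S aS; rewrite dehomB dehom_kosz mxE [X in _ + X]mxE.
have [aK|Ka] := ltnP (mdeg a) K.
  have := bP (BMultinom aK); set a' := BMultinom aK => -[ab bE].
  by rewrite (@dehom_rehom _ _ a') // bE // subrr.
have -> : dehom a (rehom b) = 0.
  apply: matrix_setP => T z; rewrite dehomE !mxE set_rankK; case: ifP => // le.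
  rewrite raddf_sum big1 //= => a' le'; rewrite mcoeffZ mcoeffX.
  case: eqP => [e|]; last by rewrite mulr0.
  have := bmdeg a'; rewrite -(submK le') e submK // ltnNge.
  by rewrite Ka.
rewrite mulmx0 [X in _ - X]mxE subr0 dehomE; case/andP: aS => le _; rewrite le.
apply/eqP; rewrite mcoeff_eq0; apply: contraL Ka => /msize_mdeg_lt lt.
rewrite -ltnNge -(submK le) mdegD ltnS addnC leq_add //.
  by rewrite mdeg_mset (leq_trans (max_card _)) ?card_ord.
by rewrite (leq_trans (ltnW lt)) // (bigD1 (set_rank S)) //= leq_addr.
Qed.

(* The contracting homotopy is multiplication by e_v followed by division
   by x_v. *)
Lemma bounds_contract D (a : 'X_{1..n}) v c : a v != 0%N ->
  (forall S, v \notin S -> surv D a S = surv D a (v |: S)) ->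
  below a c -> (forall T, surv D a T -> (k1 *m c) (set_rank T) 0 = 0) ->
  bounds D a c.
Proof.
move=> av vD ca dc; exists (wedge k v *m c) => [S b nle|S aS].
  rewrite wedgeE; case: ifP => // vS; rewrite ca ?mulr0 //.
  apply: contra nle; rewrite !mset_le => sub.
  by rewrite -(setD1K vS) subUset sub sub1set in_set av.
have /(congr1 (fun A : 'cV_N => A (set_rank S) 0)) :=
  kosz_wedge (fun _ : 'I_n => 1 : k) v c.
rewrite scale1r mxE wedgeE; case: ifP => vS; last by rewrite addr0 => ->.
rewrite dc ?mulr0 ?addr0 => [->//|].
by rewrite vD ?setD1K // !inE eqxx.
Qed.

Lemma dehom_below a w : below a (dehom a w).
Proof. by move=> S b /negPf nle; rewrite dehomE nle. Qed.

Lemma bounds0 D a : bounds D a 0.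
Proof.
by exists 0 => [S b _|S _]; rewrite ?mulmx0 mxE.
Qed.

(** In multidegree $a\ne0$ any $v$ with $a_v\ne0$ gives a contraction. Multidegree 0 contains only
    the constant multiples of $e_\emptyset$, excluded by the second hypothesis. *)
Lemma kosz_exact_col (w : 'cV[R]_N) : kX *m w = 0 ->
  (w (set_rank set0) 0)@_0%MM = 0 -> exists e, w = kX *m e.
Proof.
move=> dw w0; have [a|e /vanishT /eqP] := @vanish_local setT w; last first.
  by rewrite subr_eq0 => /eqP ->; exists e.
have [a0|] := eqVneq a 0%MM.
  suff -> : dehom a w = 0 by apply: bounds0.
  apply: matrix_setP => S b; rewrite dehomE a0 mset_le mxE.
  rewrite (_ : msup 0 = set0) ?subset0; last first.
    by apply/setP=> i; rewrite !inE mnm0E.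
  by case: eqP => // ->; rewrite sub0m.
move=> /eqP a0; have [v av] : exists v, a v != 0%N.
  apply/existsP; apply: contra_notT a0; rewrite negb_exists => /forallP a0.
  by apply/mnmP=> i; rewrite mnm0E; have := a0 i; rewrite negbK => /eqP.
apply: (bounds_contract av); last 1 first.
- by move=> T _; rewrite -dehom_kosz dw dehomE mxE mcoeff0 if_same.
- by move=> S vS; rewrite /surv !inE !andbT !mset_le subUset sub1set in_set av.
exact: dehom_below.
Qed.

(** The class of the degree 0 component in $H_0(x;R^m)=k^m$, which by [kosz_exact] is the only
    obstruction for a cycle to be a boundary. *)
Definition const_part m (w : 'M[R]_(N, m)) : 'rV[k]_m :=
  \row_b (w (set_rank set0) b)@_0%MM.

Lemma const_part_kosz m (w : 'M[R]_(N, m)) : const_part (kX *m w) = 0.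
Proof.
apply/rowP=> b; rewrite [RHS]mxE [LHS]mxE koszE raddf_sum big1 //= => v _.
by rewrite -mulrA mcoeff_sign mcoeffXM lep1mP mnm0E mulr0.
Qed.

Lemma kosz_exact m (w : 'M[R]_(N, m)) : kX *m w = 0 -> const_part w = 0 ->
  exists e, w = kX *m e.
Proof.
move=> dw w0.
have /fin_all_exists[e eP] : forall b, exists e, col b w = kX *m e.
  move=> b; apply: kosz_exact_col; first by rewrite colE mulmxA dw mul0mx.
  by move/rowP/(_ b): w0; rewrite !mxE.
exists (\matrix_(s, b) e b s 0); apply/matrixP=> s b.
have := congr1 (fun A : 'cV_N => A s 0) (eP b); rewrite !mxE => ->.
by apply: eq_bigr => t _; rewrite !mxE.
Qed.

End PolynomialKoszul.

(** * Hochster's formula *)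

Section HomologyDim.
Variables (k : fieldType) (m n p : nat) (A : 'M[k]_(m, n)) (B : 'M[k]_(n, p)).

Lemma homology_dim_eq0 : A *m B = 0 ->
  homology_dim A B = 0%N <->
  forall u : 'rV_n, u *m B = 0 -> exists v, u = v *m A.
Proof.
move=> AB; have leAB : (A <= kermx B)%MS by apply/sub_kermxP.
have eq : (homology_dim A B == 0)%N = (kermx B <= A)%MS.
  by rewrite subn_eq0 (geq_leqif (mxrank_leqif_sup leAB)).
split=> [/eqP|ex].
  by rewrite eq => le u /sub_kermxP /submx_trans /(_ le) /submxP.
apply/eqP; rewrite eq; apply/row_subP=> i.
by apply/submxP/ex/sub_kermxP/row_sub.
Qed.

End HomologyDim.

Lemma homology_dim_tr (k : fieldType) m n p
    (A : 'M[k]_(m, n)) (B : 'M[k]_(n, p)) :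
  homology_dim A B = homology_dim B^T A^T.
Proof. by rewrite /homology_dim !mxrank_ker !mxrank_tr subnAC. Qed.

(** Transposition preserves ranks, so homology on rows can be tested as cohomology on columns, the
    side on which the Koszul matrices act. *)
Lemma homology_dim_dual (k : fieldType) m n p
    (A : 'M[k]_(m, n)) (B : 'M[k]_(n, p)) :
  A *m B = 0 ->
  homology_dim A B = 0%N <->
  forall c : 'cV_n, A *m c = 0 -> exists b, c = B *m b.
Proof.
move=> AB; rewrite homology_dim_tr homology_dim_eq0; last first.
  by rewrite -trmx_mul AB trmx0.
split=> ex u.
  rewrite -[in X in X -> _](trmxK u) -[A in X in X -> _]trmxK -trmx_mul.
  move=> /(congr1 trmx); rewrite trmxK trmx0 => /ex[v /(congr1 trmx)].
  by rewrite trmx_mul !trmxK => ->; exists v^T.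
move=> /(congr1 trmx); rewrite trmx_mul trmxK trmx0 => /ex[b /(congr1 trmx)].
by rewrite trmx_mul !trmxK => ->; exists b^T.
Qed.

(** * Simplicial cochains of an induced complex as Koszul chains *)

Section InducedComplex.
Variables (k : fieldType) (n : nat) (D : {set {set 'I_n}}) (V : {set 'I_n}).
Hypothesis Dd : down_closed D.
Local Notation N := (setN n).
Local Notation k1 := (kosz (fun _ : 'I_n => 1 : k)).
Local Notation DV := (induced D V).
Implicit Types (S T F G : {set 'I_n}).

(* Rescaling by [eps] turns the signs of the Koszul complex, which depend on
   V :\: F, into those of the simplicial coboundary, which depend on F. *)
Definition eps G : k := \prod_(v in G) (-1) ^+ pos v V.

Lemma eps_sqr G : eps G * eps G = 1.
Proof.
by rewrite -big_split big1 // => v _; rewrite /= -expr2 sqrr_sign.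
Qed.

Lemma pos_setD F v : F \subset V -> pos v V = (pos v F + pos v (V :\: F))%N.
Proof.
move=> FV; rewrite /pos -(cardsID F); congr (_ + _)%N; apply: eq_card => u.
  rewrite !inE; case: (boolP (u \in F)) => [/(subsetP FV) ->|_].
    by rewrite andbT.
  by rewrite andbF.
by rewrite !inE andbA.
Qed.

Lemma eps_setD1 F v : F \subset V -> v \in F ->
  eps F * (-1) ^+ pos v (V :\: F) = (-1) ^+ pos v F * eps (F :\ v).
Proof.
move=> FV vF; rewrite {1}/eps (big_setD1 v) //= -/(eps (F :\ v)) mulrAC.
rewrite (pos_setD v FV) exprD -(mulrA _ _ ((-1) ^+ _)) -expr2 sqrr_sign.
by rewrite mulr1.
Qed.

(** Complementation in [V] turns Koszul degree $|V|-i$ into cochains on faces of cardinality [i];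
    [uncochain] is the section extending by zero. *)
Definition cochain i (z : 'cV[k]_N) : 'cV[k]_(#|faces DV i|) :=
  \col_p (eps (enum_val p) * z (set_rank (V :\: enum_val p)) 0).

Definition uncochain i (c : 'cV[k]_(#|faces DV i|)) : 'cV[k]_N :=
  \col_s if nth_set s \subset V then
    eps (V :\: nth_set s) *
      \sum_p (enum_val p == V :\: nth_set s)%:R * c p 0 else 0.

Lemma mem_faces F i :
  (F \in faces DV i) = [&& F \in D, F \subset V & #|F| == i].
Proof. by rewrite !inE andbA. Qed.

Lemma enum_val_face i (p : 'I_#|faces DV i|) :
  [/\ enum_val p \in D, enum_val p \subset V & #|enum_val p| = i].
Proof. by have := enum_valP p; rewrite mem_faces => /and3P[? ? /eqP]. Qed.

Lemma setDDK F : F \subset V -> V :\: (V :\: F) = F.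
Proof. by move=> FV; rewrite setDDr setDv set0U; apply/setIidPr. Qed.

Lemma uncochainK i (c : 'cV[k]_(#|faces DV i|)) : cochain i (uncochain c) = c.
Proof.
apply/colP=> p; have [_ FV _] := enum_val_face p.
rewrite !mxE set_rankK subsetDl setDDK // mulrA eps_sqr mul1r.
rewrite (bigD1 p) //= eqxx mul1r big1 ?addr0 // => q /negPf qp.
by rewrite (inj_eq enum_val_inj) qp mul0r.
Qed.

Lemma uncochain_below i (c : 'cV[k]_(#|faces DV i|)) S b :
  ~~ (S \subset V) -> uncochain c (set_rank S) b = 0.
Proof. by move=> /negPf SV; rewrite mxE set_rankK SV. Qed.

Lemma uncochain_deg i (c : 'cV[k]_(#|faces DV i|)) S b :
  (#|S| + i)%N != #|V| -> uncochain c (set_rank S) b = 0.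
Proof.
move=> SV; rewrite mxE set_rankK; case: ifP => // sub.
rewrite big1 ?mulr0 // => p _; case: eqP => [e|]; last by rewrite mul0r.
have [_ _] := enum_val_face p; rewrite e cardsD (setIidPr sub) => ip.
by case/eqP: SV; rewrite -[X in (_ + X)%N]ip subnKC // subset_leq_card.
Qed.

(** On columns [boundary] is the coboundary. Removing [v] from a face $F$ adds it to $V\setminus F$,
    and [eps_setD1] reconciles the signs. *)
Lemma boundary_cochain i (z : 'cV[k]_N) :
  (forall S b, ~~ (S \subset V) -> z (set_rank S) b = 0) ->
  boundary k DV i *m cochain i z = cochain i.+1 (k1 *m z).
Proof.
move=> zV; apply/colP=> p; have [FD FV Fi] := enum_val_face p.
rewrite [RHS]mxE koszE mxE mulr_sumr; set F := enum_val p in FD FV Fi *.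
under eq_bigr do rewrite !mxE /incidence mulr_suml big_mkcondr /=.
rewrite exchange_big /= [LHS]big_mkcond [RHS]big_mkcond /=.
apply: eq_bigr => v _; rewrite -big_mkcond /= -/F inE negb_and negbK.
have [vF|vF] := boolP (v \in F); last first.
  case: ifP => //= vV; rewrite zV ?mulr0 //; apply: contra vV.
  by rewrite subUset sub1set => /andP[].
have Fv : F :\ v \in faces DV i.
  rewrite mem_faces (Dd FD) ?subD1set // (subset_trans (subD1set _ _)) //=.
  by move: Fi; rewrite (cardsD1 v) vF add1n => -[->].
rewrite (big_pred1 (enum_rank_in Fv (F :\ v))) => [|q]; last first.
  by rewrite /= -(inj_eq enum_val_inj) enum_rankK_in // eq_sym.
rewrite enum_rankK_in // /= mulr1 mulrA -/(pos v F) -eps_setD1 // !mulrA.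
congr (_ * z (set_rank _) 0).
apply/setP=> u; rewrite !inE; case: eqP => [->|_] //=; rewrite ?(subsetP FV) //.
Qed.

Lemma kosz_below (z : 'cV[k]_N) :
  (forall S b, ~~ (S \subset V) -> z (set_rank S) b = 0) ->
  (forall S b, ~~ (S \subset V) -> (k1 *m z) (set_rank S) b = 0).
Proof.
move=> zV S b SV; rewrite koszE big1 // => v vS; rewrite zV ?mulr0 //.
by apply: contra SV; rewrite subUset => /andP[].
Qed.

Lemma boundary_sqr i : boundary k DV i.+1 *m boundary k DV i = 0.
Proof.
apply/matrixP=> p q; rewrite mxE.
pose e : 'cV[k]_#|faces DV i| := delta_mx q 0.
transitivity ((boundary k DV i.+1 *m (boundary k DV i *m e)) p 0).
  by rewrite mulmxA -colE !mxE.
rewrite -(uncochainK e) !boundary_cochain //.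
- by rewrite mulmxA kosz_sqr mul0mx mxE mxE mulr0 mxE.
- by apply: kosz_below => S b; apply: uncochain_below.
- by move=> S b; apply: uncochain_below.
Qed.

End InducedComplex.

Section Hochster.
Variables (k : fieldType) (n : nat) (D : {set {set 'I_n}}).
Hypothesis Dd : down_closed D.
Local Notation R := {mpoly k[n]}.
Local Notation N := (setN n).
Local Notation kX := (kosz (fun v : 'I_n => 'X_v : R)).
Local Notation k1 := (kosz (fun _ : 'I_n => 1 : k)).
Implicit Types (S T F G V : {set 'I_n}).

(** Koszul degree [q] and internal degree [j], where $e_S$ itself has internal degree $|S|$. *)
Definition grade p (deg : 'I_p -> nat) (q j : nat) (s : 'I_N) (b : 'I_p) :
    pred 'X_{1..n} :=
  fun m => (#|nth_set s| == q) && (mdeg m + q + deg b == j)%N.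

Lemma hproj_deg p (dg : 'I_p -> nat) q j (w : 'M[R]_(N, p)) S b :
  hproj (grade dg q j) w = w -> #|S| != q -> w (set_rank S) b = 0.
Proof.
move=> <- /negPf Sq; rewrite mxE /mpart big1 // => m.
by rewrite /grade set_rankK Sq.
Qed.

Definition koszul_exact (gs : seq R) q j := forall w : 'cV[R]_N,
  hproj (grade (fun=> 0%N) q j) w = w -> mx_in gs (kX *m w) ->
  exists e, mx_in gs (w - kX *m e).

Lemma msup_mset V : msup (mset V) = V.
Proof. by apply/setP=> i; rewrite inE msetE; case: (i \in V). Qed.

Lemma surv_mset V S : surv D (mset V) S = (S \subset V) && (V :\: S \in D).
Proof.
rewrite /surv mset_le msup_mset; congr (_ && (_ \in D)).
by apply/setP=> i; rewrite !inE mnmBE !msetE; do 2!case: (_ \in _).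
Qed.

Lemma below_mset V (c : 'cV[k]_N) : below (mset V) c <->
  (forall S b, ~~ (S \subset V) -> c (set_rank S) b = 0).
Proof. by split=> cV S b; have := cV S b; rewrite mset_le msup_mset. Qed.

(** If $|S|=i$ then $V\setminus S$ has $s+1$ elements, hence dimension [s]. Reading an equation of
    cochains at that face gives the Koszul equation at [S]. *)
Lemma homology_bounds V i s : #|V| = (i + s.+1)%N ->
  reduced_homology_dim k (induced D V) s = 0%N <->
  (forall c : 'cV[k]_N, below (mset V) c -> kosz_deg i c ->
     (forall T, surv D (mset V) T -> (k1 *m c) (set_rank T) 0 = 0) ->
     bounds D (mset V) c).
Proof.
move=> Vi; rewrite /reduced_homology_dim homology_dim_dual; last first.
  exact: boundary_sqr.
split=> [ex c /below_mset cV ci dc|ex c dc].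
  have [|b] := ex (cochain D V s.+1 c).
    rewrite boundary_cochain //; apply/colP=> p.
    have [FD FV _] := enum_val_face p.
    by rewrite [RHS]mxE [LHS]mxE dc ?mulr0 // surv_mset subsetDl setDDK.
  have bV := @uncochain_below _ _ _ V s b.
  rewrite -{1}(uncochainK b) boundary_cochain // => e.
  exists (uncochain b); first exact/below_mset.
  move=> S; rewrite surv_mset => /andP[SV VSD].
  have VS : #|V :\: S| = (#|V| - #|S|)%N by rewrite cardsD (setIidPr SV).
  have Si := subset_leq_card SV.
  have [iS|iS] := eqVneq #|S| i; last first.
    rewrite ci // koszE big1 // => v vS; rewrite uncochain_deg ?mulr0 //.
    by rewrite cardsU1 vS; move/eqP: iS; lia.
  have Gf : V :\: S \in faces (induced D V) s.+1.
    by rewrite mem_faces VSD subsetDl VS; apply/eqP; lia.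
  move/colP/(_ (enum_rank_in Gf (V :\: S))): e; rewrite !mxE enum_rankK_in //.
  rewrite setDDK // => /(congr1 (fun x => eps k V (V :\: S) * x)).
  by rewrite !mulrA eps_sqr !mul1r.
have cV := @uncochain_below _ _ _ V s.+1 c.
have [|||b bV bE] := ex (uncochain c).
- exact/below_mset.
- by move=> S b iS; apply: uncochain_deg; rewrite Vi; move/eqP: iS; lia.
- move=> T; rewrite surv_mset => /andP[TV VTD].
  have VT : #|V :\: T| = (#|V| - #|T|)%N by rewrite cardsD (setIidPr TV).
  have Ti := subset_leq_card TV.
  have [iT|iT] := eqVneq #|T|.+1 i; last first.
    rewrite koszE big1 // => v vT; rewrite uncochain_deg ?mulr0 //.
    by rewrite cardsU1 vT; move/eqP: iT; lia.
  have Ff : V :\: T \in faces (induced D V) s.+2.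
    by rewrite mem_faces VTD subsetDl VT; apply/eqP; lia.
  move: dc; rewrite -(uncochainK c) boundary_cochain // uncochainK.
  move=> /colP/(_ (enum_rank_in Ff (V :\: T))); rewrite !mxE enum_rankK_in //.
  rewrite setDDK // => /(congr1 (fun x => eps k V (V :\: T) * x)).
  by rewrite !mulrA eps_sqr mul1r mulr0.
exists (cochain D V s b); rewrite boundary_cochain //; last exact/below_mset.
rewrite -[LHS]uncochainK; apply/colP=> p; have [FD FV _] := enum_val_face p.
by rewrite mxE [RHS]mxE bE // surv_mset subsetDl setDDK.
Qed.

Lemma hochster i s :
  koszul_exact (stanley_reisner k D) i (i + s.+1) <->
  forall V, #|V| = (i + s.+1)%N -> reduced_homology_dim k (induced D V) s = 0%N.
Proof.
split=> [ex V Vi|ex w wh].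
  apply/(homology_bounds Vi) => c cV ci dc.
  (* The cycle [c] is placed in the single multidegree [mset V]. *)
  pose w : 'cV[R]_N := \col_t (c t 0 *: 'X_[mset V - mset (nth_set t)]).
  have wE a : dehom a w = if a == mset V then c else 0.
    apply: matrix_setP => S b; rewrite ord1 dehomE mxE set_rankK.
    rewrite mcoeffZ mcoeffX.
    have [SV|SV] := boolP (mset S <= mset V)%MM; last first.
      by rewrite cV // mul0r if_same; case: ifP; rewrite ?mxE ?cV.
    case: (a =P mset V) => [->|aV]; first by rewrite SV eqxx mulr1.
    rewrite mxE; case: ifP => // Sa; case: eqP => [e|]; last by rewrite mulr0.
    by case: aV; rewrite -(submK Sa) -e submK.
  have [||e] := ex w.
  - apply: matrix_setP => S b; rewrite !mxE !ord1 !set_rankK; apply/mpolyP=> m.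
    rewrite mcoeff_mpart /grade mcoeffZ mcoeffX set_rankK addn0.
    case: ifP => //; case: (_ =P m) => [<-|_]; last by rewrite mulr0.
    have [iS|iS] := eqVneq #|S| i; last by rewrite ci ?mul0r.
    have [SV|SV] := boolP (mset S <= mset V)%MM; last by rewrite cV ?mul0r.
    have -> : (mdeg (mset V - mset S) + i)%N = (i + s.+1)%N.
      by rewrite -{1}iS -mdeg_mset -mdegD submK // mdeg_mset.
    by rewrite eqxx.
  - apply/vanish_stanley_reisner => // a T aT; rewrite dehom_kosz wE.
    case: eqP aT => [-> /dc //|_ _]; by rewrite mulmx0 mxE.
  move=> /vanish_stanley_reisner-/(_ Dd) we; exists (dehom (mset V) e).
    exact: dehom_below.
  move=> S /we; rewrite dehomB wE eqxx dehom_kosz mxE [X in _ + X]mxE => /eqP.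
  by rewrite subr_eq0 => /eqP.
move=> /vanish_stanley_reisner-/(_ Dd) dw.
have [a|e we] := @vanish_local _ _ D w; last first.
  by exists e; apply/vanish_stanley_reisner.
have w0 S b : dehom a w (set_rank S) b != 0 ->
    #|S| = i /\ mdeg a = (i + s.+1)%N.
  rewrite dehomE; case: ifP; rewrite ?eqxx // => Sa; rewrite -mcoeff_msupp.
  move=> /(hproj_supp wh); rewrite /grade set_rankK addn0 => /andP[/eqP Si].
  by rewrite -Si -mdeg_mset -mdegD submK // => /eqP.
have [aj|aj] := eqVneq (mdeg a) (i + s.+1)%N; last first.
  suff -> : dehom a w = 0 by apply: bounds0.
  apply: matrix_setP => S b; rewrite [RHS]mxE; apply/eqP.
  by apply: contraNT aj => /w0[_ ->].
(* If $a_v\ge2$, then for $v\notin S$ the monomials $x^{a-S}$ and $x^{a-(S\cup v)}$ have the same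
   support, so contraction along [v] is compatible with the ideal. Otherwise [a] is squarefree. *)
have [/existsP[v av]|] := boolP [exists v, 1 < a v]%N.
  apply: (@bounds_contract _ _ _ _ v).
  - by rewrite -lt0n ltnW.
  - move=> S vS; rewrite /surv !mset_le subUset sub1set in_set -lt0n.
    rewrite (ltnW av) /=; congr (_ && (_ \in D)).
    apply/setP=> u; rewrite !inE !mnmBE !msetE !inE.
    by case: (u =P v) => // ->; rewrite (negPf vS); lia.
  - exact: dehom_below.
  by move=> T /dw; rewrite dehom_kosz.
rewrite negb_exists => /forallP a1.
have aE : a = mset (msup a).
  apply/mnmP=> v; rewrite msetE in_set; have := a1 v.
  by case: (a v) => [|[]].
move: aj dw w0; rewrite aE mdeg_mset => aj dw w0.
apply: (proj1 (homology_bounds aj) (ex _ aj)).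
- exact: dehom_below.
- by move=> S b iS; apply/eqP; apply: contraNT iS => /w0[-> _].
by move=> T /dw; rewrite dehom_kosz.
Qed.

End Hochster.

(** * Dimension shifting along a resolution *)

Section DimensionShift.
Variables (k : fieldType) (n : nat) (gs : seq {mpoly k[n]}).
Hypothesis gs_mpart : forall P f, in_ideal gs f -> in_ideal gs (mpart P f).
Variable F : graded_free_resolution gs.
Local Notation R := {mpoly k[n]}.
Local Notation N := (setN n).
Local Notation kX := (kosz (fun v : 'I_n => 'X_v : R)).
Local Notation fd := (fdiff F).
Local Notation deg p := (@fdeg _ _ _ F p).

Lemma msupp_kosz s t m : m \in msupp (kX s t) ->
  mdeg m = 1%N /\ #|nth_set t| = #|nth_set s|.+1.
Proof.
rewrite mcoeff_msupp mxE raddf_sum => nz.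
have [v /and3P[vs /eqP ->]] : exists v, [&& v \notin nth_set s,
    nth_set t == v |: nth_set s
    & ((-1) ^+ pos v (nth_set s) * 'X_v : R)@_m != 0].
  apply/existsP; apply: contraNT nz; rewrite negb_exists => /forallP z.
  apply/eqP/big1 => v /andP[vs vt]; apply/eqP; have := z v.
  by rewrite vs vt /= negbK.
rewrite mcoeff_sign mcoeffX cardsU1 vs => nz'; split=> //.
move: nz'; case: (_ =P m) => [<- _|_]; first exact: mdeg1.
by rewrite mulr0 eqxx.
Qed.

Lemma hproj_kosz p (dg : 'I_p -> nat) q j (w : 'M[R]_(N, p)) :
  hproj (grade dg q j) (kX *m w) = kX *m hproj (grade dg q.+1 j) w.
Proof.
apply: hproj_mull => s t b m1 m2 /msupp_kosz[m1E tE].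
by rewrite /grade tE eqSS mdegD m1E add1n addSnnS.
Qed.

Lemma hproj_fdiff p q j w :
  hproj (grade (deg p) q j) (w *m fd p) =
    hproj (grade (deg p.+1) q j) w *m fd p.
Proof.
apply: hproj_mulr => s b c m1 m2 /fdiff_homog e.
by rewrite /grade mdegD -e; congr (_ && (_ == _)); lia.
Qed.

Lemma hproj_faug q j w :
  hproj (grade (fun=> 0%N) q j) (w *m faug F) =
    hproj (grade (deg 0) q j) w *m faug F.
Proof.
apply: hproj_mulr => s b c m1 m2; rewrite (ord1 c) => /faug_homog e.
by rewrite /grade mdegD -e; congr (_ && (_ == _)); lia.
Qed.

Lemma fdiff_sqr p : fd p.+1 *m fd p = 0.
Proof.
apply/row_matrixP=> i; rewrite row_mul row0; apply/fdiff_exact.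
by exists (delta_mx 0 i); rewrite -rowE.
Qed.

(** Elements of $K\otimes F_p$ are matrices with one row per subset: the Koszul differential acts on
    the left and that of [F] on the right, so they commute by associativity, and exactness of [F] is
    applied row by row. *)
Lemma fdiff_exactM m p (u : 'M_(m, frank F p.+1)) :
  u *m fd p = 0 -> exists v, u = v *m fd p.+1.
Proof.
move=> u0.
have /fin_all_exists[v vE] : forall i, exists v, row i u = v *m fd p.+1.
  by move=> i; apply/fdiff_exact; rewrite -row_mul u0 row0.
by exists (\matrix_i v i); apply/row_matrixP=> i; rewrite row_mul rowK.
Qed.

Lemma faug_exactM m (u : 'M_(m, frank F 0)) :
  mx_in gs (u *m faug F) <-> exists v, u = v *m fd 0.
Proof.
have rowE' (w : 'M_(m, frank F 0)) i :
    (row i w *m faug F) 0 0 = (w *m faug F) i 0.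
  by rewrite -row_mul mxE.
split=> [Ju|[v ->] i b].
  have /fin_all_exists[v vE] : forall i, exists v, row i u = v *m fd 0.
    by move=> i; apply/faug_exact; rewrite rowE'.
  by exists (\matrix_i v i); apply/row_matrixP=> i; rewrite row_mul rowK.
by rewrite ord1 -rowE'; apply/faug_exact; exists (row i v); rewrite row_mul.
Qed.

Lemma faug_ontoM m (w : 'cV[R]_m) : exists u, mx_in gs (w - u *m faug F).
Proof.
have /fin_all_exists[u uE] : forall i, exists u : 'rV_(frank F 0),
    in_ideal gs (w i 0 - (u *m faug F) 0 0).
  by move=> i; apply: faug_onto.
exists (\matrix_i u i) => i b; rewrite ord1 !mxE.
have := uE i; rewrite mxE; congr (in_ideal _ (_ - _)).
by apply: eq_bigr => c _; rewrite mxE.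
Qed.

(* H_q(x; coker (F_{p+1} -> F_p)) = 0 in degree j. *)
Definition cok_exact p q j := forall w : 'M_(N, frank F p),
  hproj (grade (deg p) q j) w = w ->
  forall t, kX *m w = t *m fd p ->
  exists a b, w = kX *m a + b *m fd p.

(* The same for p+1, but with the cycle condition expressed in F_p, where it
   makes sense also for q = 0. *)
Definition syz_exact p q j := forall w : 'M_(N, frank F p.+1),
  hproj (grade (deg p.+1) q j) w = w ->
  forall z, w *m fd p = kX *m z ->
  exists a b, w = kX *m a + b *m fd p.+1.

Lemma const_part_hproj p (dg : 'I_p -> nat) q j (w : 'M[R]_(N, p)) :
  const_part (hproj (grade dg q.+1 j) w) = 0.
Proof.
apply/rowP=> b; rewrite !mxE mcoeff_mpart /grade set_rankK cards0.
by [].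
Qed.

Lemma const_partM p r (w : 'M[R]_(N, p)) (A : 'M[R]_(p, r)) :
  const_part (w *m A) = const_part w *m map_mx (mcoeff 0%MM) A.
Proof.
apply/rowP=> b; rewrite !mxE raddf_sum; apply: eq_bigr => c _.
by rewrite !mxE; exact: rmorphM.
Qed.

Lemma const_partB p (w z : 'M[R]_(N, p)) :
  const_part (w - z) = const_part w - const_part z.
Proof. by apply/rowP=> b; rewrite !mxE mcoeffB. Qed.

(** The connecting map of $0\to\mathrm{Syz}\to F_p\to\mathrm{coker}\to0$: both sides concern pairs
    with $w\,\partial=d z$. One direction uses Koszul exactness on $F_p$, the other exactness of
    [F]. *)
Lemma syz_cok p q j : syz_exact p q j <-> cok_exact p q.+1 j.
Proof.
split=> [ex z zh w zw|ex w wh z wz].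
  have zw' : kX *m z = hproj (grade (deg p.+1) q j) w *m fd p.
    by rewrite -hproj_fdiff -zw hproj_kosz zh.
  have [a [b wE]] := ex _ (hproj_idem _ w) z (esym zw').
  (* Taking homogeneous parts ensures that $z-a'\partial$ has no component in Koszul degree 0, as
     [kosz_exact] requires. *)
  pose a' := hproj (grade (deg p.+1) q.+1 j) a.
  pose b' := hproj (grade (deg p.+2) q j) b.
  have {}wE : hproj (grade (deg p.+1) q j) w = kX *m a' + b' *m fd p.+1.
    rewrite -hproj_kosz -hproj_fdiff -(hproj_idem _ w) wE.
    apply/matrixP=> s c; rewrite !mxE; apply/mpolyP=> m.
    by rewrite mcoeffD !mcoeff_mpart mcoeffD; case: ifP; rewrite ?addr0.
  have [||e] := @kosz_exact _ _ _ (z - a' *m fd p).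
  - rewrite mulmxBr zw' wE mulmxDl -!mulmxA fdiff_sqr mulmx0 addr0.
    by rewrite !mulmxA subrr.
  - rewrite const_partB -zh const_part_hproj const_partM.
    by rewrite const_part_hproj mul0mx subr0.
  move=> /eqP; rewrite subr_eq => /eqP ->; by exists e, a'.
have wz' : w *m fd p = kX *m hproj (grade (deg p) q.+1 j) z.
  by rewrite -hproj_kosz -wz hproj_fdiff wh.
have [a [b zE]] := ex _ (hproj_idem _ z) w (esym wz').
exists b; have [|c cE] := @fdiff_exactM _ _ (w - kX *m b).
  rewrite mulmxBl wz' zE mulmxDr mulmxA kosz_sqr mul0mx add0r.
  by rewrite !mulmxA subrr.
by exists c; rewrite -cE addrC subrK.
Qed.

(** In positive Koszul degree the two cycle conditions agree: both amount to $d w\,\partial=0$, by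
    exactness of [F] and of the Koszul complex respectively. *)
Lemma cok_syz p q j : syz_exact p q.+1 j <-> cok_exact p.+1 q.+1 j.
Proof.
split=> ex w wh t e.
  have [||z zE] := @kosz_exact _ _ _ (w *m fd p).
  - by rewrite mulmxA e -mulmxA fdiff_sqr mulmx0.
  - by rewrite const_partM -wh const_part_hproj mul0mx.
  exact: ex zE.
have [|u uE] := @fdiff_exactM _ _ (kX *m w).
  by rewrite -mulmxA e mulmxA kosz_sqr mul0mx.
exact: ex uE.
Qed.

(** Each step down the resolution trades one syzygy for one Koszul degree. *)
Lemma syz_shift p q j : syz_exact p q j <-> cok_exact 0 (p + q.+1) j.
Proof.
rewrite syz_cok; elim: p q => [|p IHp] q //.
by rewrite -cok_syz syz_cok IHp addSnnS.
Qed.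

(** The augmentation identifies the cokernel of $F_1\to F_0$ with $R/(gs)$; [gs_mpart] allows a lift
    along it to be replaced by its homogeneous part. *)
Lemma cok_koszul q j : cok_exact 0 q j <-> koszul_exact gs q j.
Proof.
split=> [ex w wh Jw|ex z zh t ze].
  have [z Jz] := faug_ontoM w; pose z' := hproj (grade (deg 0) q j) z.
  have Jz' : mx_in gs (w - z' *m faug F).
    rewrite -hproj_faug -wh -hprojB => a b; rewrite mxE; exact: gs_mpart.
  have [t te] : exists t, kX *m z' = t *m fd 0.
    apply/faug_exactM; rewrite -mulmxA -[z' *m _](subKr w) mulmxBr.
    by apply: mx_inB => //; apply: mx_inM.
  have [a [b zE]] := ex z' (hproj_idem _ z) t te.
  exists (a *m faug F).
  have -> : w - kX *m (a *m faug F) =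
      (w - z' *m faug F) + (b *m fd 0) *m faug F.
    by rewrite zE mulmxDl mulmxA opprD addrA subrK.
  by apply: mx_inD => //; apply/faug_exactM; exists b.
have [||e Je] := ex (z *m faug F).
- by rewrite hproj_faug zh.
- by rewrite mulmxA; apply/faug_exactM; exists t.
have [a Ja] := faug_ontoM e.
exists a; have [|b bE] := (@faug_exactM _ (z - kX *m a)).1; last first.
  by exists b; rewrite -bE addrC subrK.
have -> : (z - kX *m a) *m faug F =
    (z *m faug F - kX *m e) + kX *m (e - a *m faug F).
  by rewrite mulmxBl mulmxBr mulmxA addrA subrK.
by apply: mx_inD => //; apply: mx_inM.
Qed.

End DimensionShift.

(** * Betti numbers and Koszul homology *)

(** The idempotents $S_i^TS_i$ commute with the differentials, so the compressed complex is a direct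
    summand of the full one. *)
Lemma homology_dim_compress (k : fieldType) m1 m2 m3 n1 n2 n3
    (S1 : 'M[k]_(m1, n1)) (S2 : 'M[k]_(m2, n2)) (S3 : 'M[k]_(m3, n3))
    (A : 'M[k]_(n1, n2)) (B : 'M[k]_(n2, n3)) :
  S1 *m S1^T = 1%:M -> S2 *m S2^T = 1%:M ->
  S1^T *m S1 *m A = A *m (S2^T *m S2) ->
  S2^T *m S2 *m B = B *m (S3^T *m S3) ->
  A *m B = 0 ->
  homology_dim (S1 *m A *m S2^T) (S2 *m B *m S3^T) = 0%N <->
  forall w : 'rV_n2, w *m (S2^T *m S2) = w -> w *m B = 0 ->
    exists v, w = v *m A.
Proof.
move=> S1K S2K SA SB AB; rewrite homology_dim_eq0; last first.
  rewrite !mulmxA -[_ *m S2^T *m S2]mulmxA -(mulmxA S1) -SA.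
  by rewrite !mulmxA -(mulmxA _ A) AB mulmx0 mul0mx.
split=> [ex w wS wB|ex u uB].
  have [|v vE] := ex (w *m S2^T).
    by rewrite !mulmxA -(mulmxA w) wS wB mul0mx.
  exists (v *m S1); rewrite -wS mulmxA vE !mulmxA -!mulmxA -SA.
  by rewrite !mulmxA -(mulmxA v) S1K mulmx1.
have [||v vE] := ex (u *m S2).
- by rewrite !mulmxA -(mulmxA u) S2K mulmx1.
- have e : S2 *m B = S2 *m B *m S3^T *m S3.
    by rewrite -!mulmxA -SB !mulmxA S2K mul1mx.
  by rewrite -mulmxA e mulmxA uB mul0mx.
exists (v *m S1^T); transitivity (v *m (S1^T *m S1 *m A) *m S2^T).
  by rewrite SA -!mulmxA S2K mulmx1 mulmxA -vE -mulmxA S2K mulmx1.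
by rewrite !mulmxA.
Qed.

Section BettiKoszul.
Variables (k : fieldType) (n : nat) (gs : seq {mpoly k[n]}).
Hypothesis gs_mpart : forall P f, in_ideal gs f -> in_ideal gs (mpart P f).
Variables (F : graded_free_resolution gs) (j : nat).
Local Notation R := {mpoly k[n]}.
Local Notation N := (setN n).
Local Notation kX := (kosz (fun v : 'I_n => 'X_v : R)).
Local Notation fd := (fdiff F).
Local Notation deg p := (@fdeg _ _ _ F p).
Local Notation cst_mx := (map_mx (mcoeff 0%MM)).

Definition sel p : 'M[k]_(#|basis_deg F p j|, frank F p) :=
  \matrix_(a, b) (enum_val a == b)%:R.

Lemma selK p : sel p *m (sel p)^T = 1%:M.
Proof.
apply/matrixP=> a b; rewrite !mxE (bigD1 (enum_val a)) //= !mxE eqxx mul1r.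
rewrite big1 ?addr0 => [|c /negPf ca]; last by rewrite !mxE eq_sym ca mul0r.
by rewrite (inj_eq enum_val_inj) eq_sym.
Qed.

Lemma selTE p b c : ((sel p)^T *m sel p) b c = ((deg p b == j) && (b == c))%:R.
Proof.
rewrite mxE; under eq_bigr do rewrite !mxE -natrM mulnb.
have [bj|bj] := boolP (deg p b == j) => /=.
  have bB : b \in basis_deg F p j by rewrite inE.
  rewrite (bigD1 (enum_rank_in bB b)) //= enum_rankK_in // eqxx big1 ?addr0 //.
  move=> a ab; rewrite -(enum_rankK_in bB bB) (inj_eq enum_val_inj).
  by rewrite (negPf ab).
rewrite big1 // => a _; case: eqP => // ab; case/negP: bj.
by have := enum_valP a; rewrite ab inE.
Qed.

Lemma mul_selT p m (A : 'M_(frank F p, m)) b c :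
  ((sel p)^T *m sel p *m A) b c = if deg p b == j then A b c else 0.
Proof.
rewrite mxE (bigD1 b) //= selTE eqxx andbT big1 ?addr0 => [|b' /negPf bb'].
  by case: ifP; rewrite ?mul1r ?mul0r.
by rewrite selTE (eq_sym b) bb' andbF mul0r.
Qed.

Lemma mul_sel p m (A : 'M_(m, frank F p)) b c :
  (A *m ((sel p)^T *m sel p)) b c = if deg p c == j then A b c else 0.
Proof.
rewrite mxE (bigD1 c) //= selTE eqxx andbT big1 ?addr0 => [|b' /negPf bb'].
  by case: ifP; rewrite ?mulr1 ?mulr0.
by rewrite selTE bb' andbF mulr0.
Qed.

(** A nonzero constant coefficient in a homogeneous matrix joins basis elements of equal degree. *)
Lemma sel_const_fdiff p :
  (sel p.+1)^T *m sel p.+1 *m cst_mx (fd p) =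
  cst_mx (fd p) *m ((sel p)^T *m sel p).
Proof.
apply/matrixP=> b c; rewrite mul_selT mul_sel mxE.
have [/fdiff_homog|] := boolP (0%MM \in msupp (fd p b c)).
  by rewrite mdeg0 add0n => ->.
by rewrite -mcoeff_eq0 => /eqP ->; rewrite !if_same.
Qed.

Lemma fdiff_kE p : fdiff_k F p j = sel p.+1 *m cst_mx (fd p) *m (sel p)^T.
Proof.
have selE m (A : 'M_(frank F p.+1, m)) a b :
    (sel p.+1 *m A) a b = A (enum_val a) b.
  rewrite mxE (bigD1 (enum_val a)) //= mxE eqxx mul1r big1 ?addr0 // => c.
  by move=> /negPf ca; rewrite mxE eq_sym ca mul0r.
apply/matrixP=> a b; rewrite -mulmxA selE !mxE (bigD1 (enum_val b)) //= !mxE.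
rewrite eqxx mulr1 big1 ?addr0 // => c /negPf cb.
by rewrite !mxE eq_sym cb mulr0.
Qed.

Lemma const_fdiff_sqr p : cst_mx (fd p.+1) *m cst_mx (fd p) = 0.
Proof. by rewrite -map_mxM fdiff_sqr map_mx0. Qed.

Definition const_exact p := forall w : 'rV[k]_(frank F p),
  w *m ((sel p)^T *m sel p) = w -> exists v, w = v *m cst_mx (fd p).

Lemma betti0_const : betti F 0 j = 0%N <-> const_exact 0.
Proof.
pose Z m : 'M[k]_(m, 0) := 0.
(* The cokernel in degree 0 becomes a homology space by appending a map to the zero space. *)
have -> : betti F 0 j = homology_dim (fdiff_k F 0 j) (sel 0 *m Z _ *m (Z 0)^T).
  by rewrite /homology_dim mulmx0 mul0mx mxrank_ker mxrank0 subn0.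
rewrite fdiff_kE homology_dim_compress ?selK ?sel_const_fdiff //;
  rewrite ?mulmx0 ?mul0mx //.
  by split=> ex w wS; [apply: ex => //; rewrite mulmx0|move=> _; apply: ex].
Qed.

Lemma bettiS_const p : betti F p.+1 j = 0%N <->
  forall w : 'rV[k]_(frank F p.+1), w *m ((sel p.+1)^T *m sel p.+1) = w ->
  w *m cst_mx (fd p) = 0 -> exists v, w = v *m cst_mx (fd p.+1).
Proof.
rewrite /betti !fdiff_kE homology_dim_compress ?selK ?sel_const_fdiff //.
exact: const_fdiff_sqr.
Qed.

(** Lifts $F_p\otimes k$ to constants in Koszul degree 0, a section of [const_part]. *)
Definition at_set0 p (u : 'rV[k]_p) : 'M[R]_(N, p) :=
  \matrix_(s, b) if nth_set s == set0 then (u 0 b)%:MP else 0.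

Lemma at_set0K p (u : 'rV[k]_p) : const_part (at_set0 u) = u.
Proof. by apply/rowP=> b; rewrite !mxE set_rankK eqxx mcoeffC eqxx mulr1. Qed.

Lemma kosz_at_set0 p (u : 'rV[k]_p) : kX *m at_set0 u = 0.
Proof.
apply: matrix_setP => T b; rewrite koszE [RHS]mxE big1 // => v _.
rewrite mxE set_rankK; case: eqP => [/setP/(_ v)|]; last by rewrite mulr0.
by rewrite !inE eqxx.
Qed.

Lemma hproj_at_set0 p (u : 'rV[k]_(frank F p)) :
  u *m ((sel p)^T *m sel p) = u ->
  hproj (grade (deg p) 0 j) (at_set0 u) = at_set0 u.
Proof.
move=> uS; apply/matrixP=> s b; rewrite !mxE; apply/mpolyP=> m.
rewrite mcoeff_mpart /grade; case: (_ =P set0) => [->|_]; last first.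
  by rewrite mcoeff0 if_same.
rewrite cards0 mcoeffC; case: (m =P 0%MM) => [->|_]; last first.
  by rewrite mulr0 if_same.
rewrite mdeg0 mulr1 !add0n eqxx /=.
by move/rowP/(_ b): uS; rewrite mul_sel.
Qed.

Lemma const_part_sel p (w : 'M[R]_(N, frank F p)) :
  hproj (grade (deg p) 0 j) w = w ->
  const_part w *m ((sel p)^T *m sel p) = const_part w.
Proof.
move=> wh; apply/rowP=> b; rewrite mul_sel mxE; case: ifP => // bj.
apply/esym/eqP; rewrite mcoeff_eq0; apply: contraFN bj => /(hproj_supp wh).
by rewrite /grade mdeg0 => /andP[].
Qed.

Lemma const_partD p (w z : 'M[R]_(N, p)) :
  const_part (w + z) = const_part w + const_part z.
Proof. by apply/rowP=> b; rewrite !mxE mcoeffD. Qed.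

Lemma kosz_deg0 p (dg : 'I_p -> nat) (w : 'M[R]_(N, p)) :
  hproj (grade dg 0 j) w = w -> kX *m w = 0.
Proof.
move=> wh; apply: matrix_setP => T b; rewrite koszE [RHS]mxE big1 // => v vT.
by rewrite (hproj_deg _ wh) ?mulr0 // cardsU1 vT.
Qed.

(** In Koszul degree 0 being a boundary means having zero constant part, so [syz_exact] there is
    exactness of $F\otimes k$ read through [const_part] and [at_set0]. *)
Lemma bettiS_syz p : betti F p.+1 j = 0%N <-> syz_exact F p 0 j.
Proof.
rewrite bettiS_const; split=> [ex w wh z e|ex u uS uC].
  have [|v vE] := ex _ (const_part_sel wh).
    by rewrite -const_partM e const_part_kosz.
  have [||a aE] := @kosz_exact _ _ _ (w - at_set0 v *m fd p.+1).
  - by rewrite mulmxBr mulmxA kosz_at_set0 mul0mx subr0 (kosz_deg0 wh).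
  - by rewrite const_partB const_partM at_set0K -vE subrr.
  by exists a, (at_set0 v); rewrite -aE subrK.
have [||z zE] := @kosz_exact _ _ _ (at_set0 u *m fd p).
- by rewrite mulmxA kosz_at_set0 mul0mx.
- by rewrite const_partM at_set0K.
have [a [b uE]] := ex _ (hproj_at_set0 uS) z zE.
exists (const_part b); rewrite -const_partM -[LHS]at_set0K uE.
by rewrite const_partD const_part_kosz add0r.
Qed.

Lemma betti0_cok : betti F 0 j = 0%N <-> cok_exact F 0 0 j.
Proof.
rewrite betti0_const; split=> [ex w wh t _|ex u uS].
  have [v vE] := ex _ (const_part_sel wh).
  have [||a aE] := @kosz_exact _ _ _ (w - at_set0 v *m fd 0).
  - by rewrite mulmxBr mulmxA kosz_at_set0 mul0mx subr0 (kosz_deg0 wh).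
  - by rewrite const_partB const_partM at_set0K -vE subrr.
  by exists a, (at_set0 v); rewrite -aE subrK.
have [|a [b uE]] := ex _ (hproj_at_set0 uS) 0.
  by rewrite kosz_at_set0 mul0mx.
exists (const_part b); rewrite -const_partM -[LHS]at_set0K uE.
by rewrite const_partD const_part_kosz add0r.
Qed.

Lemma betti_koszul i : betti F i j = 0%N <-> koszul_exact gs i j.
Proof.
case: i => [|i]; first by rewrite betti0_cok cok_koszul.
by rewrite bettiS_syz syz_shift addn1 cok_koszul.
Qed.

End BettiKoszul.

(** * Betti numbers and depth of Stanley-Reisner rings *)

Section StanleyReisner.
Variables (k : fieldType) (n : nat) (D : {set {set 'I_n}}).
Hypothesis Dd : down_closed D.
Local Notation I := (stanley_reisner k D).
Implicit Types V : {set 'I_n}.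

Lemma stanley_reisner_mpart P f : in_ideal I f -> in_ideal I (mpart P f).
Proof.
move=> /in_stanley_reisner-/(_ Dd) If; apply/in_stanley_reisner => // m.
rewrite mcoeff_msupp mcoeff_mpart; case: ifP; rewrite ?eqxx // => _.
by rewrite -mcoeff_msupp; apply: If.
Qed.

Lemma betti_homology (F : graded_free_resolution I) i s :
  betti F i (i + s.+1) != 0%N <->
  exists2 V : {set 'I_n}, #|V| = (i + s.+1)%N &
    reduced_homology_dim k (induced D V) s != 0%N.
Proof.
have bh : betti F i (i + s.+1) = 0%N <->
    forall V : {set 'I_n}, #|V| = (i + s.+1)%N ->
    reduced_homology_dim k (induced D V) s = 0%N.
  by rewrite betti_koszul ?hochster //; apply: stanley_reisner_mpart.
split=> [bn0|[V Vi]]; last by apply: contraNneq => /bh ->.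
have [/existsP[V /andP[/eqP Vi Vs]]|] := boolP [exists V : {set 'I_n},
    (#|V| == i + s.+1)%N && (reduced_homology_dim k (induced D V) s != 0%N)].
  by exists V.
rewrite negb_exists => /forallP none; case/eqP: bn0; apply/bh => V Vi.
by apply/eqP; have := none V; rewrite Vi eqxx negbK.
Qed.

(** If $i=|V|-s-1$ exceeded $n$ minus the length of [fs], [kosz_depth] would kill $H_i(x;R/I)$, and
    with it the homology by [hochster]. *)
Lemma homology_depth_bound fs V s : regular_seq I fs ->
  (forall f, f \in fs -> in_ideal [seq 'X_i | i <- enum 'I_n] f) ->
  reduced_homology_dim k (induced D V) s != 0%N ->
  exists2 i, #|V| = (i + s.+1)%N & (i + size fs <= n)%N.
Proof.
(* A nonzero class needs a face with $s+1$ elements, so the truncated subtraction defining [i] is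
   exact. *)
move=> reg fsX Vs; have sV : (s < #|V|)%N.
  rewrite ltnNge; apply: contra Vs => Vs.
  rewrite /reduced_homology_dim /homology_dim subn_eq0.
  have faces0 : #|faces (induced D V) s.+1| = 0%N.
    apply/eqP; rewrite cards_eq0; apply/eqP/setP=> G.
    rewrite mem_faces [RHS]inE.
    apply/negbTE; apply: contraL Vs => /and3P[_ /subset_leq_card GV /eqP GE].
    by rewrite -ltnNge -GE.
  by rewrite (leq_trans (rank_leq_row _)) // [X in (X <= _)%N]faces0.
exists (#|V| - s.+1)%N; first by rewrite subnK.
rewrite leqNgt; apply: contra Vs => lt.
have Vi : #|V| = (#|V| - s.+1 + s.+1)%N by rewrite subnK.
apply/eqP/(proj1 (hochster k Dd (#|V| - s.+1) s)) => // w wh Iw.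
apply: (kosz_depth reg fsX lt _ Iw) => S b iS.
exact: hproj_deg wh iS.
Qed.

End StanleyReisner.

(** * Connectivity of the clique complex *)

Lemma clique_complex_down_closed n d (H : hypergraph n) :
  down_closed (clique_complex d H).
Proof.
move=> G T; rewrite !inE => /forallP GH TG; apply/forallP=> e.
apply/implyP=> /andP[eT ed]; have := GH e.
by rewrite (subset_trans eT TG) ed.
Qed.

Theorem theorem5p8 (k : fieldType) (n d : nat) (H : hypergraph n)
    (hd : (2 <= d)%N) (hH : uniform d H)
    (F : graded_free_resolution (stanley_reisner k (clique_complex d H)))
    (g : nat) (hg : is_depth (stanley_reisner k (clique_complex d H)) g)
    (r : nat) :
  let r_by_betti := is_min (fun s => exists2 i : nat, (i + g + s)%N = n &
      betti F i (i + (d - 1)) != 0%N) r in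
  let r_by_homology := is_min (fun s => exists2 V : {set 'I_n},
      #|V|%:Z = n%:Z - (g%:Z - d%:Z + s%:Z + 1) &
      reduced_homology_dim k (induced (clique_complex d H) V) d.-2 != 0%N) r in
  (r_by_betti <-> r_by_homology) /\
  (r_by_betti -> exists2 c : nat, is_connectivity k d H c &
      c%:Z = g%:Z - d%:Z + r%:Z + 1).
Proof.
move: d hd hH F hg => [|[|t]] // _ hH F hg; rewrite subn1 /=.
set D := clique_complex t.+2 H in F hg *.
have Dd : down_closed D by apply: clique_complex_down_closed.
have bound V : reduced_homology_dim k (induced D V) t != 0%N ->
    exists2 i, #|V| = (i + t.+1)%N & (i + g <= n)%N.
  by case: hg => -[fs [reg fsX] <-] _; apply: homology_depth_bound.
pose byB s := exists2 i : nat, (i + g + s)%N = n &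
  betti F i (i + t.+1) != 0%N.
pose byH s := exists2 V : {set 'I_n},
  #|V|%:Z = n%:Z - (g%:Z - t.+2%:Z + s%:Z + 1) &
  reduced_homology_dim k (induced D V) t != 0%N.
(* Both cardinality conditions say $i=n-g-s$ with $|V|=i+d-1$; from homology, [bound] supplies this
   [i] as a natural number. *)
have equiv s : byB s <-> byH s.
  split=> [[i igs /(betti_homology Dd)[V Vi Vt]]|[V Ve Vt]].
    by exists V => //; lia.
  have [i Vi ign] := bound V Vt; exists i; first by lia.
  by apply/(betti_homology Dd); exists V.
have mequiv : is_min byB r <-> is_min byH r.
  by split=> -[/equiv Pr min]; split=> // l /equiv /min.
split=> // /mequiv [[V Ve Vt] min].
have cV := cardsC V; rewrite card_ord in cV.
exists #|~: V|; last by lia.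
split; first by exists (~: V); rewrite ?setCK.
move=> _ [W <- Wt]; have [i Wi ign] := bound _ Wt.
have cW := cardsC W; rewrite card_ord in cW.
(* Since $i+g\le n$, the number $n-i-g$ is not truncated and competes with [r]; its minimality
   bounds $|W|=n-i-d+1$ below by $g+r-d+1$. *)
have : (r <= n - i - g)%N by apply: min; exists (~: W) => //; lia.
by lia.
Qed.
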